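(* Let $n \geq 2$ be an integer, $R = \mathbb{Z}_n \times \mathbb{Z}_n$, and $m=\phi(n)$. Let $R_1=\{(u_1,z_1)\mid u_1 \in U(\mathbb{Z}_n),\ z_1 \in Z(\mathbb{Z}_n)\}$ and $R_2 = \{(z_2,u_2)\mid u_2 \in U(\mathbb{Z}_n),\ z_2 \in Z(\mathbb{Z}_n)\}$, and let $ZD(R_1\cup R_2)$ be the induced subgraph of $ZD(R)$ with vertex set $R_1\cup R_2$. Then: (1) If $n$ is prime, then $ZD(R_1\cup R_2) = ZD(\mathbb{Z}_n \times \mathbb{Z}_n) = \Gamma(R) = K_{n-1,n-1}$. (2) If $n$ is not prime, then $ZD(R_1\cup R_2)$ is the disjoint union of $n - m$ copies of $K_{m,m}$.
   Context: $\mathbb{Z}_n$ is the ring of integers modulo $n$, $\phi$ is Euler's totient function, $U(\cdot)$ is the group of units of a ring, and $Z(\cdot)$ is its set of zero-divisors, with $0$ included. For $x=(x_1,x_2), y=(y_1,y_2)\in R=\mathbb{Z}_n\times\mathbb{Z}_n$, the dot product is $x\cdot y = x_1y_1+x_2y_2\in\mathbb{Z}_n$. The zero-divisor dot product graph $ZD(R)$ is the simple undirected graph with vertex set $Z(R)\setminus\{(0,0)\}$, in which two distinct vertices $x,y$ are adjacent if and only if $x\cdot y=0$. The zero-divisor graph $\Gamma(R)$ is the simple graph with vertex set $Z(R)\setminus\{0\}$, in which distinct $x,y$ are adjacent if and only if $xy=0$ (ring product in $R$). $K_{m,m}$ is the complete bipartite graph with parts of size $m$ and $m$; equality with such a graph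 means isomorphism, the other equalities being equalities of graphs on the same vertex set. A graph is the disjoint union of given graphs if its vertex set is partitioned into subsets inducing (isomorphic copies of) those graphs, with no edges between vertices in different subsets. *)

(* Defs.v *)
From HB Require Import structures.
From mathcomp Require Import all_boot all_order all_algebra.
Set Implicit Arguments.
Unset Strict Implicit.
Unset Printing Implicit Defensive.
Import GRing.Theory.
Local Open Scope ring_scope.

(* Edges are two-element sets of vertices, so that equality of graphs sharing
   an ambient type is Leibniz equality. *)
Record sgraph (T : finType) := SGraph {
  vset : {set T};
  eset : {set {set T}};
  eset_wf : [forall e in eset, (#|e| == 2%N) && (e \subset vset)]
}.

Definition adj (T : finType) (G : sgraph T) : rel T :=
  fun x y => [set x; y] \in eset G.

Definition rel_edges (T : finType) (V : {set T}) (r : rel T) : {set {set T}} :=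
  [set e | [exists x in V, exists y in V,
              [&& x != y, r x y & e == [set x; y]]]].

Lemma rel_edges_wf (T : finType) (V : {set T}) (r : rel T) :
  [forall e in rel_edges V r, (#|e| == 2%N) && (e \subset V)].
Proof.
apply/forall_inP => e; rewrite inE => /exists_inP[x xV] /exists_inP[y yV].
by case/and3P=> xy _ /eqP->; rewrite cards2 xy subUset !sub1set xV yV.
Qed.

(* Intended for symmetric r; loops of r are discarded. *)
Definition rel_graph (T : finType) (V : {set T}) (r : rel T) : sgraph T :=
  SGraph (rel_edges_wf V r).

Lemma adj_rel_graph (T : finType) (V : {set T}) (r : rel T) x y :
  symmetric r ->
  adj (rel_graph V r) x y = [&& x \in V, y \in V, x != y & r x y].
Proof.
move=> symr; rewrite /adj /= inE.
apply/exists_inP/and4P => [[a aV /exists_inP[b bV /and3P[ab rab /eqP E]]]|].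
  have xab : x \in [set a; b] by rewrite -E set21.
  have yab : y \in [set a; b] by rewrite -E set22.
  have axy : a \in [set x; y] by rewrite E set21.
  have bxy : b \in [set x; y] by rewrite E set22.
  move: xab yab axy bxy; rewrite !inE.
  case/orP=> /eqP-> /orP[]/eqP->; rewrite ?orbb.
  - by move=> _ /eqP ba; rewrite ba eqxx in ab.
  - by split.
  - by split; rewrite 1?eq_sym 1?symr.
  - by move=> /eqP ba; rewrite ba eqxx in ab.
case=> xV yV xy rxy; exists x => //; apply/exists_inP; exists y => //.
by rewrite xy rxy eqxx.
Qed.

Definition induced_edges (T : finType) (G : sgraph T) (A : {set T}) :
  {set {set T}} := [set e in eset G | e \subset A].

Lemma induced_edges_wf (T : finType) (G : sgraph T) (A : {set T}) :
  [forall e in induced_edges G A,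
     (#|e| == 2%N) && (e \subset vset G :&: A)].
Proof.
apply/forall_inP => e; rewrite inE subsetI => /andP[eG ->].
by have /forall_inP/(_ e eG)/andP[-> ->] := eset_wf G.
Qed.

Definition induced (T : finType) (G : sgraph T) (A : {set T}) : sgraph T :=
  SGraph (induced_edges_wf G A).

Definition isomorphic (T S : finType) (G : sgraph T) (H : sgraph S) : Prop :=
  exists2 f : {x : T | x \in vset G} -> {y : S | y \in vset H},
    bijective f & forall x y, adj H (val (f x)) (val (f y)) = adj G (val x) (val y).

Definition complete_bipartite (a b : nat) : sgraph ('I_a + 'I_b)%type :=
  rel_graph [set: 'I_a + 'I_b] (fun u v =>
    match u, v with inl _, inr _ | inr _, inl _ => true | _, _ => false end).

Definition is_disjoint_union (T S : finType) (k : nat) (G : sgraph T)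
    (H : 'I_k -> sgraph S) : Prop :=
  exists P : 'I_k -> {set T},
    [/\ \bigcup_i P i = vset G,
        forall i j, i != j -> [disjoint P i & P j],
        forall i, isomorphic (induced G (P i)) (H i)
      & forall i j x y, i != j -> x \in P i -> y \in P j -> ~~ adj G x y].

(* 0 belongs to zero_divisors R because 0 * 1 = 0 and 1 != 0 in R. *)
Definition zero_divisors (R : finComNzRingType) : {set R} :=
  [set x | [exists y, (y != 0) && (x * y == 0)]].

Definition units (R : finComUnitRingType) : {set R} :=
  [set x | x \is a GRing.unit].

(* The library does not declare the finite-ring structure of a product. *)
HB.instance Definition _ (A B : finComNzRingType) := Finite.on (A * B)%type.

Definition dot (A : finComNzRingType) (x y : A * A) : A :=
  x.1 * y.1 + x.2 * y.2.

Definition zd_dot_graph (A : finComNzRingType) : sgraph (A * A)%type :=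
  rel_graph (zero_divisors (A * A)%type :\ 0) (fun x y => dot x y == 0).

Definition zd_graph (R : finComNzRingType) : sgraph R :=
  rel_graph (zero_divisors R :\ 0) (fun x y => x * y == 0).

Definition R1 (A : finComUnitRingType) : {set A * A} :=
  setX (units A) (zero_divisors A).

Definition R2 (A : finComUnitRingType) : {set A * A} :=
  setX (zero_divisors A) (units A).

Lemma R12_sub_vset (A : finComUnitRingType) :
  R1 A :|: R2 A \subset vset (zd_dot_graph A).
Proof.
apply/subsetP => -[a b]; rewrite !inE /=.
case/orP=> /andP[].
  move=> ua /existsP[y /andP[y0 /eqP by0]]; apply/andP; split.
    by apply: contraTneq ua => -[-> _]; rewrite unitr0.
  apply/existsP; exists (0, y); apply/andP; split.
    by apply: contraNneq y0 => -[->].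
  by apply/eqP; congr pair; rewrite /= ?mulr0.
move=> /existsP[y /andP[y0 /eqP ay0]] ub; apply/andP; split.
  by apply: contraTneq ub => -[_ ->]; rewrite unitr0.
apply/existsP; exists (y, 0); apply/andP; split.
  by apply: contraNneq y0 => -[->].
by apply/eqP; congr pair; rewrite /= ?mulr0.
Qed.

Definition zd_dot_graph12 (A : finComUnitRingType) : sgraph (A * A)%type :=
  induced (zd_dot_graph A) (R1 A :|: R2 A).

Lemma vset_zd_dot_graph12 (A : finComUnitRingType) :
  vset (zd_dot_graph12 A) = R1 A :|: R2 A.
Proof. exact/setIidPr/R12_sub_vset. Qed.

(* Main.v *)
Require Import Defs.
From HB Require Import structures.
From mathcomp Require Import all_boot all_order all_algebra.
From mathcomp Require Import ring.
Set Implicit Arguments.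
Unset Strict Implicit.
Unset Printing Implicit Defensive.

(** Nothing is special about Z_n: let A be any finite commutative ring.  Its
    zero-divisors are exactly its non-units ([zero_divisors_units]), so a
    vertex of R_1 u R_2 is a pair with exactly one invertible coordinate.  A
    vertex of R_1 is a unit multiple of (1, c) and a vertex of R_2 is a unit
    multiple of (-c, 1), for a unique c, its slope, which is a zero-divisor.

    Two vertices on the same side are never orthogonal: their dot product is a
    unit plus a non-unit product, and vanishing would make that product a unit.
    Two vertices on opposite sides, x = u (1, c) and y = v (-d, 1), have dot
    product (c - d) u v, which vanishes exactly when c = d.  Hence adjacency
    means opposite sides and equal slopes ([dot_eq0]), so each slope c
    contributes one complete bipartite component, with both parts in bijection
    with the units ([slope_class_iso]).  There are as many components as
    zero-divisors: n - phi(n) of them for Z_n.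

    If A is a field, the only slope is 0, which leaves one component, and the
    nonzero zero-divisors of A * A are the pairs with exactly one nonzero
    coordinate.  On such pairs the dot product and the ring product vanish
    simultaneously, since at most one of the two coordinate products is
    nonzero. *)

Import GRing.Theory.
Local Open Scope ring_scope.

(** * Graphs *)

Lemma sgraph_eq (T : finType) (G H : sgraph T) :
  vset G = vset H -> eset G = eset H -> G = H.
Proof.
case: G => V E wfE; case: H => W F wfF /= eqV eqE; subst W F.
by rewrite (bool_irrelevance wfE wfF).
Qed.

Lemma adj_induced (T : finType) (G : sgraph T) (A : {set T}) x y :
  adj (induced G A) x y = [&& adj G x y, x \in A & y \in A].
Proof. by rewrite /adj inE subUset !sub1set. Qed.

Lemma induced_vset (T : finType) (G : sgraph T) : induced G (vset G) = G.
Proof.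
apply: sgraph_eq; first exact: setIid.
apply/setP => e; rewrite inE andb_idr // => eG.
by have /forall_inP/(_ e eG)/andP[] := eset_wf G.
Qed.

Lemma eq_rel_graph (T : finType) (V : {set T}) (r s : rel T) :
  {in V &, r =2 s} -> rel_graph V r = rel_graph V s.
Proof.
move=> eq_rs; apply: sgraph_eq => //; apply/setP => e; rewrite !inE.
apply: eq_existsb => x; apply: andb_id2l => xV.
by apply: eq_existsb => y; apply: andb_id2l => yV; rewrite eq_rs.
Qed.

(** Isomorphisms onto [complete_bipartite a b] are easier to build backwards,
    as a labelling of the vertices of G: the labels form a plain type, while
    the vertices of G form a subtype. *)
Lemma isomorphic_complete_bipartite (T : finType) (G : sgraph T) (a b : nat)
    (h : 'I_a + 'I_b -> T) :
  injective h ->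
  (forall x, reflect (exists u, x = h u) (x \in vset G)) ->
  (forall u v, adj G (h u) (h v) = (is_inl u != is_inl v)) ->
  isomorphic G (complete_bipartite a b).
Proof.
move=> inj_h hP adj_h.
have hV u : h u \in vset G by apply/hP; exists u.
have pre (x : {x | x \in vset G}) : {u | h u == val x}.
  by apply: sigW; case/hP: (valP x) => u ->; exists u.
pose f x : {u | u \in vset (complete_bipartite a b)} :=
  exist _ (sval (pre x)) (in_setT _).
have fK x : h (val (f x)) = val x by apply/eqP/(svalP (pre x)).
exists f.
  exists (fun u => exist _ (h (val u)) (hV (val u))) => [x|u].
    by apply: val_inj; rewrite /= -[RHS]fK.
  by apply: val_inj; apply: inj_h; rewrite fK.
move=> x y; rewrite -!fK adj_h adj_rel_graph; last by case=> ? [].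
rewrite !in_setT /=; case: (sval (pre x)) (sval (pre y)) => i [] j //=;
  by rewrite ?andbF.
Qed.

(** * Units and zero-divisors of a finite commutative ring *)

Section FiniteRing.
Variable A : finComUnitRingType.
Implicit Types (c : A) (x y : A * A).

(** By finiteness, multiplication by an element that divides no nonzero
    element into zero is injective, hence onto, hence hits 1. *)
Lemma zero_divisors_units : zero_divisors A = ~: units A.
Proof.
apply/setP => a; rewrite !inE; apply/existsP/idP.
  case=> b /andP[b_neq0 /eqP ab0]; apply: contra b_neq0 => ua.
  by rewrite -(mulKr ua b) ab0 mulr0.
move=> Nua; apply/existsP; apply: contraR Nua => /existsPn regular_a.
have inj_a : injective ( *%R a).
  move=> b d /eqP; rewrite -subr_eq0 -mulrBr => abd.
  apply/eqP; rewrite -subr_eq0.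
  by move: (regular_a (b - d)); rewrite abd andbT negbK.
have [g _ gK] := injF_bij inj_a.
by apply/unitrPr; exists (g 1); rewrite gK.
Qed.

Lemma in_zero_divisors c : (c \in zero_divisors A) = (c \isn't a GRing.unit).
Proof. by rewrite zero_divisors_units !inE. Qed.

Lemma in_R12 x :
  (x \in R1 A :|: R2 A) = (x.1 \is a GRing.unit) (+) (x.2 \is a GRing.unit).
Proof.
rewrite inE [x]surjective_pairing !in_setX /= !in_zero_divisors !inE.
by do 2!case: (_ \is a GRing.unit).
Qed.

(** * Slopes *)

(** The slope of u (1, c) in R_1, and also of u (-c, 1) in R_2, is c: the
    second line is the orthogonal of the first, so orthogonal vertices get the
    same slope. *)
Definition slope x : A :=
  if x.1 \is a GRing.unit then x.2 / x.1 else - (x.1 / x.2).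

Lemma slope_zero_divisor x :
  x \in R1 A :|: R2 A -> slope x \in zero_divisors A.
Proof.
rewrite in_R12 in_zero_divisors /slope.
case: ifP => u1 /= u2; first by rewrite unitrM negb_and u2.
by rewrite unitrN unitrM u1.
Qed.

Lemma dot_eq0 x y :
  x \in R1 A :|: R2 A -> y \in R1 A :|: R2 A ->
  (dot x y == 0) =
    ((x.1 \is a GRing.unit) != (y.1 \is a GRing.unit)) && (slope x == slope y).
Proof.
have unit_nonunit (a b c d : A) : a \is a GRing.unit -> b \is a GRing.unit ->
    c \isn't a GRing.unit -> (a * b + c * d == 0) = false.
  move=> ua ub; apply: contraNF; rewrite addr_eq0 => /eqP abcd.
  have : a * b \is a GRing.unit by rewrite unitrM ua.
  by rewrite abcd unitrN unitrM => /andP[].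
case: x y => x1 x2 [y1 y2]; rewrite !in_R12 /slope /dot /=.
case: ifP => ux1; case: ifP => uy1 /= ux2 uy2.
- exact: unit_nonunit.
- (* The dot product of u (1, c) and v (-d, 1), with c = x2 / x1 and
     - d = y1 / y2. *)
  have -> : x1 * y1 + x2 * y2 = (x2 / x1 + y1 / y2) * (x1 * y2).
    by rewrite -{1}(divrK ux1 x2) -{1}(divrK uy2 y1); ring.
  by rewrite mulIr_eq0 ?addr_eq0 //; apply: mulIr; rewrite unitrM ux1.
- have -> : x1 * y1 + x2 * y2 = (y2 / y1 + x1 / x2) * (x2 * y1).
    by rewrite -{1}(divrK ux2 x1) -{1}(divrK uy1 y2); ring.
  rewrite mulIr_eq0; last by apply: mulIr; rewrite unitrM ux2.
  by rewrite addr_eq0 eq_sym.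
- by rewrite addrC unit_nonunit ?ux1.
Qed.

Lemma adj_zd_dot_graph12 x y :
  adj (zd_dot_graph12 A) x y =
    [&& x \in R1 A :|: R2 A, y \in R1 A :|: R2 A,
        (x.1 \is a GRing.unit) != (y.1 \is a GRing.unit)
      & slope x == slope y].
Proof.
have sub z : z \in R1 A :|: R2 A -> z \in zero_divisors (A * A)%type :\ 0.
  exact/subsetP/R12_sub_vset.
rewrite adj_induced adj_rel_graph; last first.
  by move=> z t; rewrite /dot mulrC [z.2 * _]mulrC.
have [xR|_] := boolP (x \in _ :|: _); last by rewrite andbF.
have [yR|_] := boolP (y \in R1 A :|: R2 A); last by rewrite /= andbF.
rewrite !sub // dot_eq0 //= andbT.
have [->|//] := eqVneq x y; by rewrite eqxx.
Qed.

Definition slope_class c : {set A * A} :=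
  [set x in R1 A :|: R2 A | slope x == c].

(** The units label both parts: u stands for u (1, c) on one side and for
    u (-c, 1) on the other.  These vertices are distinct because c is not
    a unit, so that the first coordinate tells the sides apart. *)
Lemma slope_class_iso c : c \in zero_divisors A ->
  isomorphic (induced (zd_dot_graph12 A) (slope_class c))
             (complete_bipartite #|units A| #|units A|).
Proof.
rewrite in_zero_divisors => Nuc.
have unit_val (i : 'I_#|units A|) : enum_val i \is a GRing.unit.
  by have := enum_valP i; rewrite inE.
pose h (u : 'I_#|units A| + 'I_#|units A|) : A * A :=
  match u with
  | inl i => (enum_val i, c * enum_val i)
  | inr j => (- (c * enum_val j), enum_val j)
  end.
have h1 u : ((h u).1 \is a GRing.unit) = is_inl u.
  by case: u => i /=; rewrite ?unit_val // unitrN unitrM (negPf Nuc).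
have h2 u : ((h u).2 \is a GRing.unit) = ~~ is_inl u.
  by case: u => i /=; rewrite ?unit_val // unitrM (negPf Nuc).
have hR u : h u \in R1 A :|: R2 A by rewrite in_R12 h1 h2; case: u.
have slope_h u : slope (h u) = c.
  by rewrite /slope h1; case: u => i /=; rewrite ?mulNr ?opprK mulrK.
have class_h u : h u \in slope_class c by rewrite inE hR slope_h eqxx.
apply: (@isomorphic_complete_bipartite _ _ _ _ h).
- move=> u v huv; have := h1 u; rewrite huv h1.
  by case: u v huv => i [] j //= [] => [/enum_val_inj|_ /enum_val_inj] ->.
- move=> x; rewrite inE vset_zd_dot_graph12.
  apply: (iffP andP) => [[_] | [u ->]]; last by rewrite hR class_h.
  rewrite inE in_R12 => /andP[xR /eqP]; rewrite /slope.
  case: x xR => x1 x2 /=; case: ifP => u1 /= u2 slope_x.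
    have x1U : x1 \in units A by rewrite inE.
    exists (inl (enum_rank_in x1U x1)).
    by rewrite /h -slope_x enum_rankK_in // divrK.
  have x2U : x2 \in units A by rewrite inE.
  exists (inr (enum_rank_in x2U x2)).
  by rewrite /h -slope_x enum_rankK_in // mulNr opprK divrK.
- move=> u v; rewrite adj_induced !class_h adj_zd_dot_graph12 !hR !h1 !slope_h.
  by rewrite eqxx !andbT.
Qed.

Lemma zd_dot_graph12_disjoint_union (k m : nat) :
  #|zero_divisors A| = k -> #|units A| = m ->
  is_disjoint_union (zd_dot_graph12 A)
    (fun _ : 'I_k => complete_bipartite m m).
Proof.
move=> <- <-; exists (fun i => slope_class (enum_val i)); split.
- rewrite vset_zd_dot_graph12; apply/setP => x.
  apply/bigcupP/idP => [[i _] | xR]; first by rewrite inE => /andP[].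
  have sZ := slope_zero_divisor xR.
  by exists (enum_rank_in sZ (slope x)); rewrite // inE xR enum_rankK_in /=.
- move=> i j neq_ij; apply/pred0P => x /=; rewrite !inE.
  apply: contraNF neq_ij => /andP[/andP[_ /eqP->]] /andP[_ /eqP eq_ij].
  exact/eqP/enum_val_inj.
- by move=> i; apply/slope_class_iso/enum_valP.
- move=> i j x y neq_ij; rewrite !inE => /andP[_ /eqP sx] /andP[_ /eqP sy].
  rewrite adj_zd_dot_graph12 sx sy (inj_eq enum_val_inj) (negPf neq_ij).
  by rewrite !andbF.
Qed.

(** * Fields *)

Section Field.
Hypothesis fieldA : forall c, (c \is a GRing.unit) = (c != 0).

Lemma zero_divisors_field : zero_divisors A = [set 0].
Proof. by apply/setP => c; rewrite in_zero_divisors fieldA negbK inE. Qed.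

(** Killing a nonzero pair forbids two invertible coordinates, in any ring;
    over a field, being nonzero forbids two non-invertible ones. *)
Lemma R12_field : R1 A :|: R2 A = zero_divisors (A * A)%type :\ 0.
Proof.
apply/eqP; rewrite eqEsubset; apply/andP; split; first exact: R12_sub_vset.
apply/subsetP => -[a b]; rewrite in_R12 !inE => /andP[ab_neq0].
case/existsP => -[c d] /andP[cd_neq0 /eqP[ac0 bd0]] /=.
have [ua|Nua] := boolP (a \is a GRing.unit).
  apply: contra cd_neq0 => ub.
  by rewrite -(mulKr ua c) -(mulKr ub d) ac0 bd0 !mulr0.
rewrite /= fieldA; apply: contra ab_neq0 => /eqP->.
by move: Nua; rewrite fieldA negbK => /eqP->.
Qed.

Lemma zd_dot_graph12_field : zd_dot_graph12 A = zd_dot_graph A.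
Proof. by rewrite /zd_dot_graph12 R12_field (induced_vset (zd_dot_graph A)). Qed.

Lemma zd_dot_graph_field : zd_dot_graph A = zd_graph (A * A)%type.
Proof.
apply: eq_rel_graph => x y; rewrite -R12_field !in_R12 !fieldA /dot.
case: x y => a b [c d] /=; rewrite -[RHS]/((a * c == 0) && (b * d == 0)).
have [->|a0] /= := eqVneq a 0; first by rewrite !mul0r add0r eqxx.
by rewrite negbK => /eqP-> _; rewrite !mul0r addr0 eqxx andbT.
Qed.

Lemma zd_graph_field_iso :
  isomorphic (zd_graph (A * A)%type)
             (complete_bipartite #|units A| #|units A|).
Proof.
have class0 : slope_class 0 = vset (zd_dot_graph12 A).
  rewrite vset_zd_dot_graph12; apply/setP => x.
  rewrite [LHS]inE andb_idr // => /slope_zero_divisor.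
  by rewrite zero_divisors_field inE.
rewrite -zd_dot_graph_field -zd_dot_graph12_field.
rewrite -[zd_dot_graph12 A]induced_vset -class0.
by apply: slope_class_iso; rewrite zero_divisors_field inE.
Qed.

End Field.

End FiniteRing.

(** * The ring of integers modulo n *)

Lemma card_units_Zn (n : nat) : (1 < n)%N -> #|units 'Z_n| = totient n.
Proof.
move=> n_gt1; rewrite -card_units_Zp ?(ltnW n_gt1) //.
rewrite -(card_imset _ val_inj); apply: eq_card => c.
rewrite inE; apply/idP/imsetP => [uc | [u _ ->]]; last exact: valP.
by exists (FinRing.unit 'Z_n uc); rewrite ?inE.
Qed.

Lemma card_zero_divisors_Zn (n : nat) :
  (1 < n)%N -> #|zero_divisors 'Z_n| = (n - totient n)%N.
Proof.
move=> n_gt1; rewrite zero_divisors_units cardsCs setCK card_units_Zn //.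
by rewrite card_ord Zp_cast.
Qed.

Lemma unit_Zp_prime (p : nat) (c : 'Z_p) :
  prime p -> (c \is a GRing.unit) = (c != 0).
Proof.
move=> p_pr; have p_gt1 := prime_gt1 p_pr.
rewrite -[c in LHS]natr_Zp unitZpE // prime_coprime //.
have c_lt_p : (c < p)%N by rewrite -[p in ltnRHS](Zp_cast p_gt1).
rewrite -val_eqE /=; have [->|c_neq0] := posnP c; first by rewrite dvdn0.
by rewrite gtnNdvd // -lt0n.
Qed.

Local Close Scope ring_scope.

Theorem theorem4p1 (n : nat) (hn : 1 < n) :
  (prime n ->
     [/\ zd_dot_graph12 'Z_n = zd_dot_graph 'Z_n,
         zd_dot_graph 'Z_n = zd_graph ('Z_n * 'Z_n)%type
       & isomorphic (zd_graph ('Z_n * 'Z_n)%type)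
                    (complete_bipartite (n - 1) (n - 1))])
  /\
  (~~ prime n ->
     is_disjoint_union (zd_dot_graph12 'Z_n)
       (fun _ : 'I_(n - totient n) =>
          complete_bipartite (totient n) (totient n))).
Proof.
split=> [n_pr | _]; last first.
  apply: zd_dot_graph12_disjoint_union; last exact: card_units_Zn.
  exact: card_zero_divisors_Zn.
have fieldZn c := @unit_Zp_prime n c n_pr.
split; [exact: zd_dot_graph12_field | exact: zd_dot_graph_field |].
have -> : n - 1 = #|units 'Z_n|.
  by rewrite card_units_Zn // totient_prime // subn1.
exact: zd_graph_field_iso.
Qed.
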